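(* Let $Y$ be an integer-valued random variable with mean $\mu$ and finite variance $\sigma^2>0$, let $Y^\star$ have the discrete $Y$-zero biased distribution, and let $\kappa=\min\{i\in\mathbb{Z}: i\ge\mu\}$. Then $$d_{\mathrm{TV}}(\mathcal{L}(Y),\Psi(\mu,\sigma^2))\le\sum_{i=\kappa}^{\infty}|\mathbb{P}(Y=i)-\mathbb{P}(Y^\star=i)|+\sum_{i=-\infty}^{\kappa-1}|\mathbb{P}(Y=i)-\mathbb{P}(Y^\star+1=i)|.$$
   Context: $\mathcal{L}(X)$ denotes the distribution of $X$. For probability measures $\mathbf{Q}_1,\mathbf{Q}_2$ on $\mathbb{Z}$, $d_{\mathrm{TV}}(\mathbf{Q}_1,\mathbf{Q}_2)=\sup_{A\subset\mathbb{Z}}|\mathbf{Q}_1(A)-\mathbf{Q}_2(A)|$. Discrete zero bias: for a function $f:\mathbb{Z}\to\mathbb{R}$ let $\Delta f(i)=f(i+1)-f(i)$. For an integer-valued random variable $Y$ with mean $\mu$ and finite variance $\sigma^2>0$, an integer-valued random variable $Y^\star$ has the discrete $Y$-zero biased distribution if $\mathbb{E}[(Y-\mu)f(Y)]=\sigma^2\,\mathbb{E}\Delta f(Y^\star)$ for all bounded $f:\mathbb{Z}\to\mathbb{R}$. This distribution exists and is unique; it is given by $\mathbb{P}(Y^\star=j-1)=\mathbb{E}[(Y-\mu)\mathbf{1}_{(Y\ge j)}]/\sigma^2$, $j\in\mathbb{Z}$. The distribution $\Psi_\kappa(\mu,\sigma^2)$: for $\mu\in\mathbb{R}$, $\sigma^2>0$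 and an integer $\kappa$ with $\mu-\sigma^2\le\kappa<\mu+\sigma^2+1$, define for functions $f$ on $\mathbb{Z}$ $$\mathcal{B}f(i)=\begin{cases}\sigma^2f(i+1)-(\sigma^2+i-\mu)f(i), & i\ge\kappa,\\ (\sigma^2+\mu-i)f(i+1)-\sigma^2f(i), & i\le\kappa-1.\end{cases}$$ $\Psi_\kappa(\mu,\sigma^2)$ is the unique distribution of an integer-valued random variable $S$ such that $\mathbb{E}\mathcal{B}f(S)=0$ for all bounded $f:\mathbb{Z}\to\mathbb{R}$. Explicitly, $\pi_j=\mathbb{P}(S=j)$ satisfies $\pi_j=\left(\prod_{i=\kappa+1}^{j}\frac{\sigma^2}{\sigma^2+i-\mu}\right)\pi_\kappa$ for $j\ge\kappa+1$, $\pi_{\kappa-1}=\frac{\sigma^2+\kappa-\mu}{\sigma^2+\mu-\kappa+1}\pi_\kappa$, $\pi_j=\left(\prod_{i=j}^{\kappa-2}\frac{\sigma^2}{\sigma^2+\mu-i}\right)\pi_{\kappa-1}$ for $j\le\kappa-2$, with $\pi_\kappa$ determined by $\sum_{j\in\mathbb{Z}}\pi_j=1$. We write $\Psi(\mu,\sigma^2)$ for $\Psi_\kappa(\mu,\sigma^2)$ with the choice $\kappa=\min\{i\in\mathbb{Z}:i\ge\mu\}$. *)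

(* Defs.v *)
From HB Require Import structures.
From mathcomp Require Import all_boot all_order all_algebra.
From mathcomp Require Import all_classical all_reals all_analysis.
Set Implicit Arguments.
Unset Strict Implicit.
Unset Printing Implicit Defensive.
Import Order.TTheory GRing.Theory Num.Theory.
Import numFieldNormedType.Exports.
Local Open Scope classical_set_scope.
Local Open Scope ring_scope.

(* The library gives [nat] the discrete sigma-algebra, but not [int].
   An integer-valued random variable is thus a [Y : {RV P >-> int}], with law
   [distribution P Y : probability int R]. *)
HB.instance Definition _ := isPointed.Build int 0.
HB.instance Definition _ := @isMeasurable.Build default_measure_display
  int discrete_measurable discrete_measurable0
  discrete_measurableC discrete_measurableU.

(* [Y] as a real-valued function, to which ['E_P] and ['V_P] apply. *)
Definition realRV (R : realType) (d : measure_display) (T : measurableType d)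
    (P : probability T R) (Y : {RV P >-> int}) : T -> R :=
  fun t => (Y t)%:~R.

Definition dTV (R : realType) (Q1 Q2 : probability int R) : \bar R :=
  ereal_sup [set `|Q1 A - Q2 A|%E | A in [set: set int]].

Definition fdiff (R : realType) (f : int -> R) (i : int) : R :=
  f (i + 1) - f i.

(* [Ystar] need not live on the same probability space as [Y]. For bounded [f]
   both expectations are finite as soon as [Y] has a finite mean. *)
Definition discrete_zero_biased (R : realType)
    (d : measure_display) (T : measurableType d) (P : probability T R)
    (d' : measure_display) (T' : measurableType d') (P' : probability T' R)
    (Y : {RV P >-> int}) (mu sigma2 : R) (Ystar : {RV P' >-> int}) : Prop :=
  forall f : int -> R, bounded_fun f ->
    ('E_P[fun t => ((realRV Y t - mu) * f (Y t))%R] =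
     sigma2%:E * 'E_P'[fun t => fdiff f (Ystar t)])%E.

Definition stein_op (R : realType) (kappa : int) (mu sigma2 : R)
    (f : int -> R) (i : int) : R :=
  if kappa <= i then sigma2 * f (i + 1) - (sigma2 + i%:~R - mu) * f i
  else (sigma2 + mu - i%:~R) * f (i + 1) - sigma2 * f i.

(* [Q] is the law Psi_kappa(mu, sigma2). As [stein_op] does not preserve
   boundedness, integrability is part of what "has expectation 0" says. *)
Definition is_Psi (R : realType) (kappa : int) (mu sigma2 : R)
    (Q : probability int R) : Prop :=
  [/\ 0 < sigma2,
      mu - sigma2 <= kappa%:~R < mu + sigma2 + 1 &
      forall f : int -> R, bounded_fun f ->
        Q.-integrable [set: int] (EFin \o stein_op kappa mu sigma2 f) /\
        ('E_Q[stein_op kappa mu sigma2 f] = 0)%E].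

(* Main.v *)
Require Import Defs.
From HB Require Import structures.
From mathcomp Require Import all_boot all_order all_algebra.
From mathcomp Require Import all_classical all_reals all_analysis.
From mathcomp Require Import ring lra zify.
Set Implicit Arguments.
Unset Strict Implicit.
Unset Printing Implicit Defensive.
Import Order.TTheory GRing.Theory Num.Theory.
Import numFieldNormedType.Exports.
Local Open Scope classical_set_scope.
Local Open Scope ring_scope.

(** The proof is Stein's method for a birth-death chain. Write
    B f(i) = a(i) f(i+1) - b(i) f(i), where a and b are the birth and death
    rates of the chain on the integers with stationary law Psi. Because kappa
    is the ceiling of mu, a is nonincreasing, b is nondecreasing, both are at
    least sigma2, and a(i) - b(i) = mu - i.

    Stein equation. For a set A the equation B f = 1_A - Psi(A) has an explicit
    bounded solution f (lemmas [stein_solP], [stein_sol_bounded]), and the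
    monotonicity of the rates gives |sigma2 Delta f| <= 1
    ([stein_sol_lipschitz]). The only facts about Psi behind these bounds are
    detailed balance and two inequalities between consecutive tails
    ([left_tail_growth], [right_tail_decay]). All three result from testing the
    stationarity E[B f(S)] = 0 on indicators of points and of half-lines and
    comparing the rates at different points, so the explicit weights of Psi
    never appear.

    Zero bias. Let g(i) = f(i) for i >= kappa and g(i) = f(i+1) for i < kappa.
    Then B f(i) = sigma2 Delta f(i) - (i - mu) g(i). Moreover
    Delta g(i) equals Delta f(i) for i >= kappa, zero for i = kappa - 1, and
    Delta f(i+1) for i < kappa - 1. Taking expectations of B f = 1_A - Psi(A)
    at Y and applying the zero bias identity to g, with Z the zero biased
    variable, one finds that P(Y in A) - Psi(A) is the sum of
      E[phi(Y); Y >= kappa] - E[phi(Z); Z >= kappa]   and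
      E[phi(Y); Y < kappa] - E[phi(Z + 1); Z + 1 < kappa],
    where phi = sigma2 Delta f is bounded by 1. Each difference is at most the
    l1 distance of the two laws on the half-line concerned ([le_esum_laws]). *)

(** * Expectations of functions of an integer *)

Section IntegralOverInt.
Variable R : realType.
Implicit Types (Q : probability int R) (D : set int) (f : int -> R).

Lemma ge0_integral_int Q (f : int -> \bar R) : (forall i, 0 <= f i)%E ->
  (\int[Q]_i f i = \esum_(i in [set: int]) f i * Q [set i])%E.
Proof.
move=> f0.
(* Countable additivity is indexed by nat, so the integers are enumerated
   by [pickle]; each [F n] has at most one element. *)
pose F n : set int := [set i | pickle i = n].
have tF : trivIset setT F by move=> m n _ _ [i [/= <- <-]].
have UF : \bigcup_n F n = setT.
  by apply/seteqP; split => // i _; exists (pickle i).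
rewrite -UF ge0_integral_bigcup// nneseries_esumT; last first.
  by move=> n; apply: integral_ge0.
rewrite esum_bigcupT//; last by move=> i; rewrite mule_ge0.
apply: eq_esum => n _.
have [[i Fi]|F0] := pselect (F n !=set0); last first.
  have -> : F n = set0 by apply/nonemptyPn.
  by rewrite integral_set0 esum_set0.
have -> : F n = [set i].
  apply/seteqP; split => [j Fj|j ->//].
  by apply/(pcan_inj pickleK); rewrite Fj Fi.
rewrite esum_set1; last by rewrite mule_ge0.
rewrite -integral_cst//; apply: eq_integral => j.
by rewrite inE => ->.
Qed.

Lemma bounded_fun_le f (M : R) : (forall i, `|f i| <= M) -> bounded_fun f.
Proof.
move=> fM; exists M; split; first exact: num_real.
by move=> x Mx i _; apply: le_trans (fM i) (ltW Mx).
Qed.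

Lemma bounded_integrable Q f (M : R) :
  (forall i, `|f i| <= M) -> Q.-integrable setT (EFin \o f).
Proof.
move=> fM; apply: measurable_bounded_integrable => //.
  by rewrite (le_lt_trans (probability_le1 Q _)) ?ltry.
exact: bounded_fun_le fM.
Qed.

(** The positive and negative parts of [f] are treated apart: moving all
    negative terms to the other side leaves an inequality between sums of
    nonnegative terms, which holds term by term without any discussion of
    convergence. *)
Lemma le_esum_laws Q1 Q2 D f : (forall i, `|f i| <= 1) ->
  (forall i, ~ D i -> f i = 0) ->
  (`| \int[Q1]_i f i - \int[Q2]_i f i |%:E <=
   \esum_(i in D) `|Q1 [set i] - Q2 [set i]|)%E.
Proof.
move=> f1 fD.
set S := (esum _ _).
have half (P1 P2 : probability int R) :
  S = (\esum_(i in D) `|P1 [set i] - P2 [set i]|)%E ->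
  ((\int[P1]_i f i)%R%:E - (\int[P2]_i f i)%R%:E <= S)%E.
  move=> SE.
  pose fp i := Num.max (f i) 0 : R; pose fn i := Num.max (- f i) 0 : R.
  have p0 i : 0 <= fp i by rewrite le_max lexx orbT.
  have n0 i : 0 <= fn i by rewrite le_max lexx orbT.
  have fE i : f i = fp i - fn i.
    by rewrite /fp /fn; case: (lerP (f i) 0); case: (lerP (- f i) 0); lra.
  have Ip (P : probability int R) : P.-integrable setT (EFin \o fp).
    apply: (@bounded_integrable P _ 1) => i.
    by rewrite ger0_norm// ge_max ler01 andbT (le_trans (ler_norm _)).
  have In (P : probability int R) : P.-integrable setT (EFin \o fn).
    apply: (@bounded_integrable P _ 1) => i.
    rewrite ger0_norm// ge_max ler01 andbT.
    by rewrite (le_trans (ler_norm _))// normrN.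
  have E (P : probability int R) :
      (\int[P]_i f i = \int[P]_i fp i - \int[P]_i fn i)%R.
    rewrite -RintegralB; [|by []|exact: Ip|exact: In].
    by apply: eq_Rintegral => i _; exact: fE.
  have key : (\int[P1]_i (fp i)%:E + \int[P2]_i (fn i)%:E <=
      \int[P2]_i (fp i)%:E + \int[P1]_i (fn i)%:E + S)%E.
    rewrite !ge0_integral_int; do ?by move=> i; rewrite lee_fin.
    rewrite SE (esum_mkcond D) -!esumD; do ?by move=> i _;
      rewrite ?adde_ge0// ?mule_ge0// ?lee_fin//; case: ifP.
    apply: le_esum => i _.
    have p1 : P1 [set i] \is a fin_num by exact: fin_num_measure.
    have p2 : P2 [set i] \is a fin_num by exact: fin_num_measure.
    rewrite -(fineK p1) -(fineK p2) -!EFinM -EFinB.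
    set x := fine _; set y := fine _; have := fE i.
    case: ifPn => [iD|]; last first.
      rewrite notin_setE => /fD -> fpn.
      have -> : fp i = fn i by lra.
      by rewrite adde0 addeC.
    rewrite -!EFinD lee_fin.
    have : (f i * (x - y) <= `|x - y|)%R.
      by rewrite (le_trans (ler_norm _))// normrM ler_piMl.
    by move=> + fpn; rewrite fpn; lra.
  have toR (P : probability int R) (g : int -> R) :
      P.-integrable setT (EFin \o g) ->
      (\int[P]_i (g i)%:E = (\int[P]_i g i)%R%:E)%E.
    by move=> Ig; rewrite fineK//; exact: integrable_fin_num.
  move: key; rewrite !(toR _ _ (Ip _)) !(toR _ _ (In _)) !E -?EFinB -!EFinD.
  have : (0 <= S)%E by apply: esum_ge0 => i _; exact: abse_ge0.
  case: (S) => [r| |]//; last by move=> _ _; rewrite leey.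
  by rewrite -EFinD !lee_fin; lra.
have SC : S = (\esum_(i in D) `|Q2 [set i] - Q1 [set i]|)%E.
  apply: eq_esum => i _.
  have p1 : Q1 [set i] \is a fin_num by exact: fin_num_measure.
  have p2 : Q2 [set i] \is a fin_num by exact: fin_num_measure.
  by rewrite -(fineK p1) -(fineK p2) -!EFinB/= distrC.
have [d0|d0] := lerP 0 (\int[Q1]_i f i - \int[Q2]_i f i)%R.
  by rewrite ?ger0_norm// EFinB; exact: half.
by rewrite ?ltr0_norm// opprB EFinB; exact: half.
Qed.
End IntegralOverInt.

(** * Probabilities of decidable sets of integers *)

Section LawOfPredicate.
Variables (R : realType) (Q : probability int R).
Implicit Types p q r : pred int.

Definition prob p : R := fine (Q [set j | p j]).

Lemma indicator_bounded p (i : int) : `|(p i)%:R : R| <= 1.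
Proof. by case: (p i); rewrite ?normr1 ?normr0. Qed.

Lemma integrable_indicator p :
  Q.-integrable [set: int] (EFin \o (fun j => (p j)%:R : R)).
Proof.
by apply: (@bounded_integrable _ Q _ 1) => j; exact: indicator_bounded.
Qed.

Lemma Rintegral_indicator p : (\int[Q]_j (p j)%:R)%R = prob p.
Proof.
rewrite -[prob p]mul1r -Rintegral_cst// [RHS]Rintegral_mkcond.
apply: eq_Rintegral => j _; rewrite patchE.
case: ifPn; first by rewrite inE/= => ->.
by rewrite notin_setE/= => /negP/negbTE ->.
Qed.

Lemma prob_ge0 p : 0 <= prob p.
Proof. by rewrite fine_ge0. Qed.

Lemma eq_prob p q : p =1 q -> prob p = prob q.
Proof. by move=> pq; rewrite /prob (_ : p = q)//; exact/funext. Qed.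

Lemma prob0 : prob pred0 = 0.
Proof. by rewrite -Rintegral_indicator /= Rintegral_cst// mul0r. Qed.

Lemma probT : prob predT = 1.
Proof.
rewrite /prob; have -> : [set j | predT j] = [set: int] by apply/seteqP.
by rewrite probability_setT.
Qed.

Lemma probD p q r : (forall j, p j = q j (+) r j) ->
  (forall j, ~~ (q j && r j)) -> prob p = prob q + prob r.
Proof.
move=> pqr qr; rewrite -!Rintegral_indicator -RintegralD;
  [|by []|exact: integrable_indicator..].
apply: eq_Rintegral => j _; rewrite pqr.
by move: (qr j); case: (q j); case: (r j) => //=; rewrite ?addr0 ?add0r.
Qed.

Lemma prob_mono p q : (forall j, p j -> q j) -> prob p <= prob q.
Proof.
move=> pq; rewrite (@probD q p [pred j | q j && ~~ p j]) ?lerDl ?prob_ge0//.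
  by move=> j /=; move: (pq j); case: (p j) => [->//|_]; case: (q j).
by move=> j /=; case: (p j); rewrite ?andbF.
Qed.

Lemma prob_atom p i :
  prob [pred j | p j && (j == i)] = (p i)%:R * prob (pred1 i).
Proof.
have [pi|/negbTE pi] := boolP (p i); rewrite ?mul1r ?mul0r.
  by apply: eq_prob => j /=; have [->|] := eqVneq j i; rewrite ?pi ?andbF.
rewrite -prob0; apply: eq_prob => j /=.
by have [->|] := eqVneq j i; rewrite ?pi ?andbF.
Qed.

Lemma prob_le_split p i : prob [pred j | p j && (j <= i)%R] =
  prob [pred j | p j && (j < i)%R] + (p i)%:R * prob (pred1 i).
Proof.
by rewrite -prob_atom; apply: probD => j /=; case: (p j) => //=; lia.
Qed.

Lemma prob_split p i : prob p = prob [pred j | p j && (j < i)%R] +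
  (p i)%:R * prob (pred1 i) + prob [pred j | p j && (i < j)%R].
Proof.
by rewrite -prob_le_split; apply: probD => j /=; case: (p j) => //=; lia.
Qed.

Lemma prob_leE i : prob [pred j | (j <= i)%R] =
  prob [pred j | (j < i)%R] + prob (pred1 i).
Proof. by apply: probD => j /=; lia. Qed.

Lemma prob_geE i : prob [pred j | (i <= j)%R] =
  prob (pred1 i) + prob [pred j | (i < j)%R].
Proof. by apply: probD => j /=; lia. Qed.

Lemma prob_lt_eq_gt i :
  prob [pred j | (j < i)%R] + prob (pred1 i) + prob [pred j | (i < j)%R] = 1.
Proof. by rewrite -probT -prob_leE; apply/esym/probD => j /=; lia. Qed.

End LawOfPredicate.

(** * The Stein equation of a birth-death chain on the integers *)

Section BirthDeath.
Variables (R : realType) (Q : probability int R).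
Variables (alpha beta : int -> R) (s : R).
Hypothesis s_gt0 : 0 < s.
Hypothesis s_le_alpha : forall i, s <= alpha i.
Hypothesis s_le_beta : forall i, s <= beta i.
Hypothesis alpha_noninc : forall i j, i <= j -> alpha j <= alpha i.
Hypothesis beta_nondec : forall i j, i <= j -> beta i <= beta j.
Hypothesis stationary : forall f : int -> R, bounded_fun f ->
  Q.-integrable [set: int]
    (EFin \o (fun i => alpha i * f (i + 1) - beta i * f i)) /\
  (\int[Q]_i (alpha i * f (i + 1) - beta i * f i))%R = 0.

Local Notation pr := (prob Q).

(** The way in which stationarity is used: an upper bound of the generator
    applied to [f] by a combination of two indicators, which unlike the
    generator itself is bounded, has nonnegative expectation. *)
Lemma stationary_le (f : int -> R) (M a b : R) (p q : pred int) :
  (forall i, `|f i| <= M) ->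
  (forall i,
    alpha i * f (i + 1) - beta i * f i <= a * (p i)%:R + b * (q i)%:R) ->
  0 <= a * pr p + b * pr q.
Proof.
move=> fM le; have [If <-] := stationary (bounded_fun_le fM).
have Ip (c : R) (t : pred int) :
    Q.-integrable [set: int] (EFin \o (fun i => c * (t i)%:R)).
  apply: (@bounded_integrable _ Q _ `|c|) => i.
  by rewrite normrM ler_piMr// indicator_bounded.
rewrite -!Rintegral_indicator -!RintegralZl//; do ?exact: integrable_indicator.
rewrite -RintegralD//.
apply: le_Rintegral => //.
apply: (@bounded_integrable _ Q _ (`|a| + `|b|)) => i.
rewrite (le_trans (ler_normD _ _))// lerD// normrM ler_piMr//;
  exact: indicator_bounded.
Qed.

Lemma alpha_gt0 i : 0 < alpha i. Proof. exact: lt_le_trans (s_le_alpha i). Qed.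
Lemma beta_gt0 i : 0 < beta i. Proof. exact: lt_le_trans (s_le_beta i). Qed.

(** Stationarity tested on the indicator of [i + 1], and on its opposite. *)
Lemma detailed_balance i :
  alpha i * pr (pred1 i) = beta (i + 1) * pr (pred1 (i + 1)).
Proof.
have bN (c : R) : `|c| <= 1 -> forall j : int, `|c * (j == i + 1)%:R| <= 1.
  by move=> c1 j; case: eqP; rewrite ?mulr1 ?mulr0 ?normr0.
apply/eqP; rewrite eq_le; apply/andP; split.
- have := @stationary_le _ 1 (- alpha i) (beta (i + 1))
    (pred1 i) (pred1 (i + 1)) (bN (-1) _).
  rewrite normrN1 => /(_ (lexx _)) H.
  rewrite -subr_ge0 addrC -mulNr; apply: H => j /=; rewrite (inj_eq (addIr 1)).
  by have [e1|_] := eqVneq j i; have [e2|_] := eqVneq j (i + 1);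
    [lia|rewrite e1|rewrite e2|]; rewrite /= ?mulr1n ?mulr0n; lra.
- have := @stationary_le _ 1 (alpha i) (- beta (i + 1))
    (pred1 i) (pred1 (i + 1)) (bN 1 _).
  rewrite normr1 => /(_ (lexx _)) H.
  rewrite -subr_ge0 -mulNr; apply: H => j /=; rewrite (inj_eq (addIr 1)).
  by have [e1|_] := eqVneq j i; have [e2|_] := eqVneq j (i + 1);
    [lia|rewrite e1|rewrite e2|]; rewrite /= ?mulr1n ?mulr0n; lra.
Qed.

(** Stationarity tested on the indicator of the half-line up to [i] reads
    E[alpha(S); S < i] = E[beta(S); S <= i]; on these events [alpha] is at least
    its value at [i], and [beta] at most. *)
Lemma left_tail_growth i :
  alpha i * pr [pred j | j < i] <= beta i * pr [pred j | j <= i].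
Proof.
have H := @stationary_le (fun j => - (j <= i)%R%:R) 1 (- alpha i) (beta i)
  [pred j | j < i] [pred j | j <= i].
rewrite -subr_ge0 addrC -mulNr; apply: H => j /=.
  by rewrite normrN indicator_bounded.
have -> : (j + 1 <= i) = (j < i) by lia.
have [ji|ij] := ltP j i.
  have := alpha_noninc (ltW ji); have := beta_nondec (ltW ji).
  by rewrite (ltW ji) /= ?mulr1n ?mulr0n; lra.
case: (lerP j i) => [ji|_]; last by rewrite /= ?mulr1n ?mulr0n; lra.
have -> : j = i by lia.
by rewrite /= ?mulr1n ?mulr0n; lra.
Qed.

(** The mirror image of [left_tail_growth]: E[beta(S); S > i] =
    E[alpha(S); S >= i]. *)
Lemma right_tail_decay i :
  beta i * pr [pred j | i < j] <= alpha i * pr [pred j | i <= j].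
Proof.
have H := @stationary_le (fun j => (i < j)%R%:R) 1 (alpha i) (- beta i)
  [pred j | i <= j] [pred j | i < j].
rewrite -subr_ge0 -mulNr; apply: H => j /=.
  by rewrite indicator_bounded.
have -> : (i < j + 1) = (i <= j) by lia.
have [ij|ji] := ltP i j.
  have := alpha_noninc (ltW ij); have := beta_nondec (ltW ij).
  by rewrite (ltW ij) /= ?mulr1n ?mulr0n; lra.
case: (lerP i j) => [ij|_]; last by rewrite /= ?mulr1n ?mulr0n; lra.
have -> : j = i by lia.
by rewrite /= ?mulr1n ?mulr0n; lra.
Qed.

Lemma int_ind_from (k : int) (P : int -> Prop) : P k ->
  (forall i, k <= i -> P i -> P (i + 1)) ->
  (forall i, i < k -> P (i + 1) -> P i) -> forall i, P i.
Proof.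
move=> Pk up down i.
have [ki|/ltW ik] := leP k i.
  have [n ->] : exists n : nat, i = k + n%:Z by exists `|(i - k)%R|%N; lia.
  elim: n => [|n IH]; first by rewrite addr0.
  by have -> : k + n.+1%:Z = k + n%:Z + 1 by [lia]; apply: up => //; lia.
have [n ->] : exists n : nat, i = k - n%:Z by exists `|(i - k)%R|%N; lia.
elim: n => [|n IH]; first by rewrite subr0.
apply: down; first by lia.
by have -> : k - n.+1%:Z + 1 = k - n%:Z by lia.
Qed.

(** By detailed balance a null atom would make both neighbours null, hence all
    atoms, and the total mass would vanish. *)
Lemma atom_gt0 i : 0 < pr (pred1 i).
Proof.
rewrite lt0r prob_ge0 andbT; apply/eqP => pi0.
have step j : pr (pred1 j) = 0 <-> pr (pred1 (j + 1)) = 0.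
  have := detailed_balance j; have := alpha_gt0 j; have := beta_gt0 (j + 1).
  move=> /lt0r_neq0/negbTE b0 /lt0r_neq0/negbTE a0 H.
  by split=> h; move: H; rewrite h mulr0;
   [move/esym/eqP|move/eqP]; rewrite mulf_eq0 ?a0 ?b0 => /eqP.
have all0 : forall j, pr (pred1 j) = 0.
  by apply: (int_ind_from pi0) => j _; case: (step j).
have : (\int[Q]_j (cst 1 j) = 0)%E.
  rewrite ge0_integral_int// esum1// => j _.
  rewrite /cst mul1e -[LHS]fineK ?fin_num_measure//; congr EFin; rewrite -(all0 j).
  by congr (fine (Q _)); apply/seteqP; split => k /= /eqP.
rewrite integral_cst// mul1e [LHS](probability_setT Q) => /eqP.
by rewrite onee_eq0.
Qed.

Section SteinEquation.
Variable A : pred int.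

Definition stein_num (i : int) : R :=
  pr [pred j | A j && (j < i)] - pr A * pr [pred j | j < i].

(** Multiplying the Stein equation by the mass of the atom [i] turns its
    left-hand side into an increment, by detailed balance; summing the
    right-hand side over all indices below [i] yields this formula. *)
Definition stein_sol (i : int) : R := stein_num i / (beta i * pr (pred1 i)).

Lemma stein_num_step i :
  stein_num (i + 1) - stein_num i = ((A i)%:R - pr A) * pr (pred1 i).
Proof.
rewrite /stein_num.
have -> : pr [pred j | A j && (j < i + 1)] = pr [pred j | A j && (j <= i)].
  by apply: eq_prob => j /=; congr (_ && _); lia.
have -> : pr [pred j | j < i + 1] = pr [pred j | j <= i].
  by apply: eq_prob => j /=; lia.
by rewrite prob_le_split prob_leE; ring.
Qed.

Lemma stein_sol_next i :
  stein_sol (i + 1) = stein_num (i + 1) / (alpha i * pr (pred1 i)).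
Proof. by rewrite /stein_sol detailed_balance. Qed.

Lemma stein_solP i :
  alpha i * stein_sol (i + 1) - beta i * stein_sol i = (A i)%:R - pr A.
Proof.
have a0 := lt0r_neq0 (alpha_gt0 i); have b0 := lt0r_neq0 (beta_gt0 i).
have p0 := lt0r_neq0 (atom_gt0 i).
have := stein_num_step i; rewrite stein_sol_next /stein_sol => H.
have -> : alpha i * (stein_num (i + 1) / (alpha i * pr (pred1 i))) -
  beta i * (stein_num i / (beta i * pr (pred1 i))) =
  (stein_num (i + 1) - stein_num i) / pr (pred1 i) by field; rewrite p0 a0 b0.
by rewrite H mulfK.
Qed.

(** Here [F], [p], [G] are the masses of the half-line below a point, of the
    point, and of the half-line above, while [a], [b], [c] are the masses of the
    parts of [A] therein. The increment of the solution is linear in [a], [b],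
    [c]. Its coefficients are nonpositive for [a] and [c], by the tail
    inequalities, and nonnegative for [b]. It is thus largest at [(0, p, 0)];
    it is smallest at [(F, 0, G)], where it takes the opposite value because it
    vanishes at [(F, p, G)]. *)
Lemma stein_increment_bound (F p G a b c t al be : R) :
  0 <= a <= F -> 0 <= b <= p -> 0 <= c <= G -> F + p + G = 1 ->
  0 < p -> s <= al -> s <= be ->
  al * F <= be * (F + p) -> be * G <= al * (p + G) ->
  t = a + b + c ->
  s * `|(a + b - t * (F + p)) / (al * p) - (a - t * F) / (be * p)| <= 1.
Proof.
move=> /andP[a0 aF] /andP[b0 bp] /andP[c0 cG] FpG p0 sal sbe L Rt tE.
have al0 : 0 < al by exact: lt_le_trans sal.
have be0 : 0 < be by exact: lt_le_trans sbe.
(* [w / (al * be)] is the extreme value of the increment. *)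
pose w := be * G + al * F.
have -> : (a + b - t * (F + p)) / (al * p) - (a - t * F) / (be * p) =
  (a * (be * G - al * (p + G)) + b * w - c * (be * (F + p) - al * F))
    / (al * be * p).
  by rewrite tE /w; have -> : G = 1 - F - p by [lra]; field; rewrite !gt_eqF.
set X := _ - _.
have w0 : 0 <= w by rewrite /w; apply: addr_ge0; apply: mulr_ge0 => //; lra.
have XpU : X <= p * w by rewrite /X; nra.
have XpL : - (p * w) <= X.
  have -> : - (p * w) =
      F * (be * G - al * (p + G)) - G * (be * (F + p) - al * F).
    by rewrite /w; ring.
  have h1 : F * (be * G - al * (p + G)) <= a * (be * G - al * (p + G)) by nra.
  have h2 : c * (be * (F + p) - al * F) <= G * (be * (F + p) - al * F) by nra.
  have : 0 <= b * w by exact: mulr_ge0.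
  by rewrite /X; lra.
have d0 : 0 < al * be * p by rewrite !mulr_gt0.
rewrite normrM normfV (gtr0_norm d0) mulrA ler_pdivrMr// mul1r.
have /le_trans -> // : s * `|X| <= s * (p * w).
  by rewrite ler_wpM2l ?(ltW s_gt0)// ler_norml XpL XpU.
rewrite mulrCA mulrC ler_pM2r//.
rewrite /w.
have : al * (s * F) <= al * (be * F) by rewrite ler_pM2l// ler_wpM2r//; lra.
have : be * (s * G) <= be * (al * G) by rewrite ler_pM2l// ler_wpM2r//; lra.
have : al * be * (F + G) <= al * be * 1.
  by rewrite ler_wpM2l// ?mulr_ge0 ?ltW//; lra.
by lra.
Qed.

Lemma stein_sol_lipschitz i : s * `|stein_sol (i + 1) - stein_sol i| <= 1.
Proof.
rewrite stein_sol_next /stein_sol.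
have nE := stein_num_step i.
have -> : stein_num (i + 1) =
    stein_num i + ((A i)%:R - pr A) * pr (pred1 i) by rewrite -nE; ring.
have := left_tail_growth i; have := right_tail_decay i.
rewrite prob_leE prob_geE => Rt L.
have b01 : 0 <= (A i)%:R * pr (pred1 i) <= pr (pred1 i).
  by case: (A i); rewrite ?mul1r ?mul0r prob_ge0 lexx.
have a01 : 0 <= pr [pred j | A j && (j < i)] <= pr [pred j | j < i].
  by rewrite prob_ge0 prob_mono// => j /= /andP[].
have c01 : 0 <= pr [pred j | A j && (i < j)] <= pr [pred j | i < j].
  by rewrite prob_ge0 prob_mono// => j /= /andP[].
have /= := stein_increment_bound a01 b01 c01 (prob_lt_eq_gt Q i) (atom_gt0 i)
  (s_le_alpha i) (s_le_beta i) L Rt (prob_split Q A i).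
rewrite /stein_num.
congr (_ * `|_ / _ - _| <= _); ring.
Qed.

(** With [a], [c] the masses of the two parts of [A] and [F], [G] those of the
    half-lines, [F + G = 1] gives [a - (a + c) F = a G - c F], a difference of
    two numbers between [0] and [F G]. *)
Lemma stein_num_le i : `|stein_num i| <= pr [pred j | j < i] /\
  `|stein_num i| <= pr [pred j | i <= j].
Proof.
have FG : pr [pred j | j < i] + pr [pred j | i <= j] = 1.
  by rewrite -(prob_lt_eq_gt Q i) prob_geE; ring.
have aF : pr [pred j | A j && (j < i)] <= pr [pred j | j < i].
  by rewrite prob_mono// => j /= /andP[].
have cG : pr [pred j | A j && (i <= j)] <= pr [pred j | i <= j].
  by rewrite prob_mono// => j /= /andP[].
have AE : pr A = pr [pred j | A j && (j < i)] + pr [pred j | A j && (i <= j)].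
  by apply: probD => j /=; case: (A j) => //=; lia.
have := prob_ge0 Q [pred j | A j && (j < i)].
have := prob_ge0 Q [pred j | A j && (i <= j)].
rewrite /stein_num AE; split; rewrite ler_norml; apply/andP; split; nra.
Qed.

(** The numerator of the solution is dominated by both tails, hence the solution
    by the two tails over the common denominator, [u] and [v] below. The tail
    inequalities say that [u] is nondecreasing and [v] nonincreasing, so [u]
    controls the solution on the negative half-line and [v] on the positive
    one. *)
Lemma stein_sol_bounded : exists M, forall i, `|stein_sol i| <= M.
Proof.
pose w i := beta i * pr (pred1 i).
have w0 i : 0 < w i by rewrite mulr_gt0 ?beta_gt0 ?atom_gt0.
have wS i : w (i + 1) = alpha i * pr (pred1 i) by rewrite /w detailed_balance.
pose u i := pr [pred j | j < i] / w i; pose v i := pr [pred j | i <= j] / w i.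
have ltS i : pr [pred j | j < i + 1] = pr [pred j | j <= i].
  by apply: eq_prob => j /=; lia.
have geS i : pr [pred j | i + 1 <= j] = pr [pred j | i < j].
  by apply: eq_prob => j /=; lia.
have uS i : u i <= u (i + 1).
  rewrite /u ltS wS /w !invfM ![_ * (_^-1 * _)]mulrA.
  rewrite ler_pM2r ?invr_gt0 ?atom_gt0//.
  rewrite ler_pdivrMr ?beta_gt0// mulrAC ler_pdivlMr ?alpha_gt0//.
  by rewrite mulrC [leRHS]mulrC left_tail_growth.
have vS i : v (i + 1) <= v i.
  rewrite /v geS wS /w !invfM ![_ * (_^-1 * _)]mulrA.
  rewrite ler_pM2r ?invr_gt0 ?atom_gt0//.
  rewrite ler_pdivrMr ?alpha_gt0// mulrAC ler_pdivlMr ?beta_gt0//.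
  by rewrite mulrC [leRHS]mulrC right_tail_decay.
have Su i : `|stein_sol i| <= u i.
  rewrite normrM normfV (gtr0_norm (w0 i)) ler_pM2r ?invr_gt0//.
  by have [] := stein_num_le i.
have Sv i : `|stein_sol i| <= v i.
  rewrite normrM normfV (gtr0_norm (w0 i)) ler_pM2r ?invr_gt0//.
  by have [] := stein_num_le i.
have u0 i : 0 <= u i by exact: le_trans (Su i).
have v0 i : 0 <= v i by exact: le_trans (Sv i).
exists (u 0 + v 0) => i.
have : (i <= 0 -> u i <= u 0) /\ (0 <= i -> v i <= v 0).
  elim/(@int_ind_from 0) : i => [//|i i0 [_ IH]|i i0 [IH _]]; split => i1.
  - by have -> : i + 1 = 0 by lia.
  - exact: le_trans (vS i) (IH _).
  - by apply: le_trans (uS i) (IH _); lia.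
  - by have -> : i = 0 by lia.
move=> [hu hv]; have [/hu ui|/ltW/hv vi] := leP i 0.
  by rewrite (le_trans (Su i))// (le_trans ui)// lerDl.
by rewrite (le_trans (Sv i))// (le_trans vi)// lerDr.
Qed.

End SteinEquation.
End BirthDeath.

(** * The rates of Psi *)

Section PsiRates.
Variables (R : realType) (mu sigma2 : R).
Local Notation kappa := (Num.ceil mu).

Definition Psi_birth (i : int) : R :=
  if kappa <= i then sigma2 else sigma2 + mu - i%:~R.
Definition Psi_death (i : int) : R :=
  if kappa <= i then sigma2 + i%:~R - mu else sigma2.

Lemma stein_opE f i : stein_op kappa mu sigma2 f i =
  Psi_birth i * f (i + 1) - Psi_death i * f i.
Proof. by rewrite /stein_op /Psi_birth /Psi_death; case: ifP => _; ring. Qed.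

Lemma birth_sub_death i : Psi_birth i - Psi_death i = mu - i%:~R.
Proof. by rewrite /Psi_birth /Psi_death; case: ifP => _; ring. Qed.

Lemma le_of_ceil_le i : kappa <= i -> mu <= i%:~R.
Proof. by rewrite ceil_le_int. Qed.

Lemma lt_of_lt_ceil i : i < kappa -> i%:~R < mu.
Proof. by rewrite ltNge ceil_le_int -ltNge. Qed.

(** The switch between the two forms of the rates sits at the ceiling of [mu], so
    [|i - mu|] is added to the birth rate only when [i < mu], and to the death
    rate only when [i >= mu]. *)
Lemma birth_ge i : sigma2 <= Psi_birth i.
Proof.
by rewrite /Psi_birth; case: (leP kappa i) => [//|/lt_of_lt_ceil]; lra.
Qed.

Lemma death_ge i : sigma2 <= Psi_death i.
Proof.
by rewrite /Psi_death; case: (leP kappa i) => [/le_of_ceil_le|//]; lra.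
Qed.

Lemma birth_noninc i j : i <= j -> Psi_birth j <= Psi_birth i.
Proof.
move=> ij; have := birth_ge i; rewrite /Psi_birth.
have : i%:~R <= j%:~R :> R by rewrite ler_int.
case: (leP kappa j) => // jk.
by rewrite [kappa <= i]leNgt (le_lt_trans ij jk) /=; lra.
Qed.

Lemma death_nondec i j : i <= j -> Psi_death i <= Psi_death j.
Proof.
move=> ij; have := death_ge j; rewrite /Psi_death.
have : i%:~R <= j%:~R :> R by rewrite ler_int.
by case: (leP kappa i) => // ki; rewrite (le_trans ki ij) /=; lra.
Qed.

Lemma Psi_stationary (Psi : probability int R) : is_Psi kappa mu sigma2 Psi ->
  forall f : int -> R, bounded_fun f ->
  Psi.-integrable [set: int]
    (EFin \o (fun i => Psi_birth i * f (i + 1) - Psi_death i * f i)) /\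
  (\int[Psi]_i (Psi_birth i * f (i + 1) - Psi_death i * f i))%R = 0.
Proof.
move=> [_ _ H] f /H[If Ef].
have E : stein_op kappa mu sigma2 f =
    (fun i => Psi_birth i * f (i + 1) - Psi_death i * f i).
  by apply/funext => i; rewrite stein_opE.
move: If Ef; rewrite E => If; rewrite unlock => Ef; split => //.
by rewrite /Rintegral Ef.
Qed.

End PsiRates.

(** * Comparison of the law of Y with Psi *)

(** A named successor, to carry the instance that makes [int_succ \o Ystar]
    a random variable. *)
Definition int_succ (i : int) : int := i + 1.
Lemma measurable_int_succ : measurable_fun [set: int] int_succ.
Proof. by []. Qed.
HB.instance Definition _ := @isMeasurableFun.Build _ _ int int int_succ
  measurable_int_succ.

Lemma expectation_law (R : realType) (d : measure_display) (T : measurableType d)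
    (P : probability T R) (X : {RV P >-> int}) (f : int -> R) (M : R) :
  (forall i, `|f i| <= M) ->
  ('E_P[fun t => f (X t)] = (\int[distribution P X]_i f i)%R%:E)%E.
Proof.
move=> fM; have IP : P.-integrable setT (EFin \o (f \o X)).
  apply: measurable_bounded_integrable => //.
  - by rewrite (le_lt_trans (probability_le1 P _)) ?ltry.
  - by apply: measurableT_comp.
  - exists M; split; first exact: num_real.
    by move=> x Mx i _; apply: le_trans (fM _) (ltW Mx).
rewrite unlock -(@integral_distribution _ _ _ _ _ P X (EFin \o f) _ IP)//=.
by rewrite fineK//; apply: integrable_fin_num => //; exact: bounded_integrable fM.
Qed.

Theorem theorem4p1 (R : realType)
    (d : measure_display) (T : measurableType d) (P : probability T R)
    (d' : measure_display) (T' : measurableType d') (P' : probability T' R)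
    (Y : {RV P >-> int}) (Ystar : {RV P' >-> int}) (mu sigma2 : R)
    (hL2 : realRV Y \in Lfun P 2%:E)
    (hmu : ('E_P[realRV Y] = mu%:E)%E)
    (hvar : ('V_P[realRV Y] = sigma2%:E)%E)
    (hsigma2 : 0 < sigma2)
    (hYstar : discrete_zero_biased Y mu sigma2 Ystar)
    (Psi : probability int R)
    (hPsi : is_Psi (Num.ceil mu) mu sigma2 Psi) :
  (dTV (distribution P Y) Psi <=
     \esum_(i in [set i : int | (Num.ceil mu <= i)%R])
        `| P [set t | Y t = i] - P' [set t | Ystar t = i] |
   + \esum_(i in [set i : int | (i <= Num.ceil mu - 1)%R])
        `| P [set t | Y t = i] - P' [set t | (Ystar t + 1)%R = i] |)%E.
Proof.
set kappa := Num.ceil mu.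
apply: ge_ereal_sup => _ [A _ <-].
pose p : pred int := fun i => i \in A.
pose f := stein_sol Psi (Psi_death mu sigma2) p.
have st := Psi_stationary hPsi.
have fP := stein_solP hsigma2 (birth_ge mu sigma2) (death_ge mu sigma2) st p.
have fL := stein_sol_lipschitz hsigma2 (birth_ge mu sigma2) (death_ge mu sigma2)
  (@birth_noninc _ mu sigma2) (@death_nondec _ mu sigma2) st p.
have [M fM] := stein_sol_bounded hsigma2 (birth_ge mu sigma2) (death_ge mu sigma2)
  (@birth_noninc _ mu sigma2) (@death_nondec _ mu sigma2) st p.
rewrite -/f in fP fL fM.
pose phi (i : int) : R := sigma2 * (f (i + 1) - f i).
have phi1 i : `|phi i| <= 1 by rewrite normrM (gtr0_norm hsigma2).
pose phi_up (i : int) : R := if kappa <= i then phi i else 0.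
pose phi_dn (i : int) : R := if kappa <= i then 0 else phi i.
have up1 i : `|phi_up i| <= 1 by rewrite /phi_up; case: ifP; rewrite ?normr0.
have dn1 i : `|phi_dn i| <= 1 by rewrite /phi_dn; case: ifP; rewrite ?normr0.
(* The index is shifted below [kappa] because there the unbounded part [mu - i]
   of the rates multiplies [f (i + 1)] in the generator. *)
pose g (i : int) : R := if kappa <= i then f i else f (i + 1).
have gM i : `|g i| <= M by rewrite /g; case: ifP.
have dg i : sigma2 * fdiff g i = phi_up i + phi_dn (i + 1).
  rewrite /fdiff /g /phi_up /phi_dn /phi.
  have [ki|ik] := leP kappa i; have [ki1|ik1] := leP kappa (i + 1); 
    try (exfalso; lia).
  - by rewrite addr0.
  - have -> : i + 1 = kappa by lia.
    by rewrite subrr mulr0 addr0.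
  - by rewrite add0r.
(* This is the Stein equation rearranged. Its right-hand side is bounded, hence so
   is the product on the left, whose expectation thus can be split freely. *)
have hk i : (i%:~R - mu) * g i = phi i - ((p i)%:R - prob Psi p).
  rewrite -fP /g /phi; have := birth_sub_death mu sigma2 i.
  rewrite /Psi_birth /Psi_death -/kappa; case: ifP => _ _; ring.
pose Q : probability int R := distribution P Y.
pose Qs : probability int R := distribution P' Ystar.
pose Qs1 : probability int R :=
  distribution P' [the {mfun T' >-> int} of int_succ \o Ystar].
have bI (Q' : probability int R) (h : int -> R) (N : R) :
    (forall i, `|h i| <= N) -> Q'.-integrable setT (EFin \o h).
  exact: bounded_integrable.
have toQs : (\int[Qs]_i phi_dn (i + 1) = \int[Qs1]_i phi_dn i)%R.
  apply: EFin_inj; rewrite -(@expectation_law _ _ _ P' Ystar _ 1)//.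
  by rewrite -(@expectation_law _ _ _ P'
    [the {mfun T' >-> int} of int_succ \o Ystar] _ 1).
have zero_bias : (\int[Q]_i ((i%:~R - mu) * g i) =
    \int[Qs]_i phi_up i + \int[Qs1]_i phi_dn i)%R.
  rewrite -toQs -RintegralD//; [|exact: bI up1|exact: (bI _ _ 1)].
  rewrite (_ : (fun i => phi_up i + phi_dn (i + 1)) =
    (fun i => sigma2 * fdiff g i)); last first.
    by apply/funext => i; rewrite dg.
  have dgM i : `|fdiff g i| <= M + M.
    by rewrite /fdiff (le_trans (ler_normB _ _))// lerD.
  rewrite RintegralZl//; last exact: bI dgM.
  apply: EFin_inj; rewrite EFinM.
  rewrite -(@expectation_law _ _ _ P' Ystar _ _ dgM).
  rewrite -(hYstar g (bounded_fun_le gM)).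
  rewrite -(@expectation_law _ _ _ P Y _ (1 + (1 + `|prob Psi p|)))// => i.
  rewrite hk (le_trans (ler_normB _ _))// lerD//.
  by rewrite (le_trans (ler_normB _ _))// lerD// indicator_bounded.
have lawE : (\int[Q]_i ((i%:~R - mu) * g i) =
    \int[Q]_i phi_up i + \int[Q]_i phi_dn i - (prob Q p - prob Psi p))%R.
  have cI : Q.-integrable [set: int] (EFin \o (fun=> prob Psi p)).
    by apply: (bI _ _ `|prob Psi p|) => i.
  have hI : Q.-integrable [set: int] (EFin \o (fun i => (p i)%:R - prob Psi p)).
    apply: (bI _ _ (1 + `|prob Psi p|)) => i.
    by rewrite (le_trans (ler_normB _ _))// lerD// indicator_bounded.
  have -> : (fun i => (i%:~R - mu) * g i) =
      (fun i => phi i - ((p i)%:R - prob Psi p)).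
    by apply/funext => i; rewrite hk.
  rewrite RintegralB//; last exact: bI phi1.
  rewrite (@RintegralB _ _ _ _ _ (fun i => (p i)%:R))//; last first.
    exact: integrable_indicator.
  rewrite Rintegral_indicator Rintegral_cst//.
  rewrite [X in fine X](probability_setT Q) mulr1.
  congr (_ - _); rewrite -RintegralD//; [|exact: bI up1|exact: bI dn1].
  apply: eq_Rintegral => i _; rewrite /phi_up /phi_dn.
  by case: ifP; rewrite ?addr0 ?add0r.
have AE (Q' : probability int R) : Q' A = (prob Q' p)%:E.
  rewrite /prob fineK ?fin_num_measure//; congr (Q' _).
  by apply/seteqP; split => i /=; rewrite inE.
rewrite !AE -EFinB.
have -> : (prob Q p - prob Psi p = (\int[Q]_i phi_up i - \int[Qs]_i phi_up i) +
    (\int[Q]_i phi_dn i - \int[Qs1]_i phi_dn i))%R.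
  by move: lawE; rewrite zero_bias; lra.
rewrite abse_EFin (@le_trans _ _
    (`|\int[Q]_i phi_up i - \int[Qs]_i phi_up i|%:E +
     `|\int[Q]_i phi_dn i - \int[Qs1]_i phi_dn i|%:E)%E)//.
  by rewrite -EFinD lee_fin ler_normD.
apply: leeD.
- apply: (@le_esum_laws _ Q Qs) => // i /negP/negbTE.
  by rewrite /phi_up => /= ->.
- apply: (@le_esum_laws _ Q Qs1) => // i; rewrite /phi_dn /=.
  by case: (leP kappa i) => // ik; case; lia.
Qed.
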